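(* Let $\check u^{(1)}$ and $\check u^{(2)}$ be Geronimus transformations of the bivariate linear functional $u$ associated with $L^{(a)}(z)=L^{(a)}_nz^n+\dots+L^{(a)}_{-m}z^{-m}$, $a=1,2$, where the Gram matrices $G,\check G^{(1)},\check G^{(2)}$ are quasidefinite. Put $\underline n=\max(n,m)$, $\Omega^{(1)}_2=\check S^{(1)}_2S_2^{-1}$, $\Omega^{(2)}_1=\check S^{(2)}_1S_1^{-1}$. Then for $l\ge2\underline n$ and $x_1,x_2\in\mathbb C^*$ in the domains of definition of the functions involved, $$L^{(1)}(\bar x_1)\check K^{(1),[l]}_{C,\phi}(\bar x_1,x_2)-L^{(1)}(x_2)K^{[l]}_{C,\phi}(\bar x_1,x_2)-\delta L^{(1)}(\bar x_1,x_2)=-\big[\check\phi^{(1)}_{1,l}(x_2),\dots,\check\phi^{(1)}_{1,l+2\underline n-1}(x_2)\big](\check H^{(1)}[\underline n,l])^{-1}\overline{\Omega^{(1)}_2[\underline n,l]}\begin{bmatrix}\overline{C_{2,l-2\underline n}(x_1)}\\ \vdots\\ \overline{C_{2,l-1}(x_1)}\end{bmatrix},$$ $$\check K^{(2),[l]}_{C,\phi}(\bar x_1,x_2)-K^{[l]}_{C,\phi}(\bar x_1,x_2)=-\big[\overline{\check C^{(2)}_{2,l}(x_1)},\dots,\overline{\check C^{(2)}_{2,l+2\underline n-1}(x_1)}\big](\check H^{(2)}[\underline n,l])^{-1}\Omega^{(2)}_1[\underline n,l]\begin{bmatrix}\phi_{1,l-2\underline n}(x_2)\\ \vdots\\ \phi_{1,l-1}(x_2)\end{bmatrix},$$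 $$\check K^{(1),[l]}_{\phi,C}(\bar x_1,x_2)-K^{[l]}_{\phi,C}(\bar x_1,x_2)=-\big[\check C^{(1)}_{1,l}(x_2),\dots,\check C^{(1)}_{1,l+2\underline n-1}(x_2)\big](\check H^{(1)}[\underline n,l])^{-1}\overline{\Omega^{(1)}_2[\underline n,l]}\begin{bmatrix}\overline{\phi_{2,l-2\underline n}(x_1)}\\ \vdots\\ \overline{\phi_{2,l-1}(x_1)}\end{bmatrix},$$ $$\overline{L^{(2)}}(x_2)\check K^{(2),[l]}_{\phi,C}(\bar x_1,x_2)-\overline{L^{(2)}}(\bar x_1)K^{[l]}_{\phi,C}(\bar x_1,x_2)-\delta\overline{L^{(2)}}(\bar x_1,x_2)=-\big[\overline{\check\phi^{(2)}_{2,l}(x_1)},\dots,\overline{\check\phi^{(2)}_{2,l+2\underline n-1}(x_1)}\big](\check H^{(2)}[\underline n,l])^{-1}\Omega^{(2)}_1[\underline n,l]\begin{bmatrix}C_{1,l-2\underline n}(x_2)\\ \vdots\\ C_{1,l-1}(x_2)\end{bmatrix}.$$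
   Context: Indices start at $0$; $\mathbb C^*=\mathbb C\setminus\{0\}$; a bar over a set is the set of complex conjugates, over a matrix entrywise conjugation; $\overline L(z):=\overline{L(\bar z)}$; $\delta L(x,y):=\frac{L(x)-L(y)}{x-y}$. CMV sequence: $\chi(z)=[1,z^{-1},z,z^{-2},z^2,\dots]^\top$. A bivariate linear functional $v=v_{z_1,\bar z_2}$ is a continuous linear functional with well-defined closed support in $\mathbb C^*\times\mathbb C^*$ on a space of test functions (e.g. a compactly supported distribution) containing all $f(z_1)\otimes\overline{g(z_2)}:=f(z_1)\overline{g(z_2)}$ with $f,g$ Laurent polynomials or, more generally, rational functions with nonzero poles outside $\operatorname{supp}_1(v)$, resp. $\operatorname{supp}_2(v)$, the projections of the support on the $z_1$-, resp. $z_2$-coordinate; $\langle f,g\rangle_v=\langle v,f(z_1)\otimes\overline{g(z_2)}\rangle$. The Gram matrix of $v$ has entries $\langle\chi^{(k)},\chi^{(l)}\rangle_v$; quasidefinite means that all leading principal minors are nonzero. Then $G=S_1^{-1}H(S_2^{-1})^\dagger$ (Gram matrix of $u$) uniquely, with $S_1,S_2$ lower unitriangular and $H=\operatorname{diag}(H_0,H_1,\dots)$ with nonzero entries; $\phi_a=S_a\chi=[\phi_{a,0},\phi_{a,1},\dots]^\top$. Cauchy second kind functions: $C_{1,k}(z)=\langle\phi_{1,k}(z_1),\frac1{\bar z-z_2}\rangle_u$ for $z\notin\overline{\operatorname{supp}_2(u)}$; $\overline{C_{2,k}(z)}=\langle\frac1{\bar z-z_1},\phi_{2,k}(z_2)\rangle_u$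 for $z\notin\overline{\operatorname{supp}_1(u)}$. Mixed Christoffel–Darboux kernels: $K^{[l]}_{C,\phi}(\bar x_1,x_2)=\sum_{k=0}^{l-1}\overline{C_{2,k}(x_1)}H_k^{-1}\phi_{1,k}(x_2)$, $K^{[l]}_{\phi,C}(\bar x_1,x_2)=\sum_{k=0}^{l-1}\overline{\phi_{2,k}(x_1)}H_k^{-1}C_{1,k}(x_2)$. $L^{(a)}_nL^{(a)}_{-m}\ne0$, $n,m\in\{0,1,\dots\}$, and the zero sets $\sigma(L^{(a)})\subset\mathbb C^*$ satisfy $\sigma(L^{(1)})\cap\operatorname{supp}_1(u)=\varnothing$, $\sigma(L^{(2)})\cap\operatorname{supp}_2(u)=\varnothing$. Geronimus transformations are bivariate functionals with $L^{(1)}(z_1)\check u^{(1)}=u$ and $\check u^{(2)}\overline{L^{(2)}(z_2)}=u$, i.e. $\langle L^{(1)}f,g\rangle_{\check u^{(1)}}=\langle f,g\rangle_u$ and $\langle f,L^{(2)}g\rangle_{\check u^{(2)}}=\langle f,g\rangle_u$ for admissible test functions. Explicitly, with zeros $\zeta^{(a)}_i$ of multiplicity $m^{(a)}_i$ ($i=1,\dots,d^{(a)}$) and univariate linear functionals $\xi^{(a)}_{i,r}$, $0\le r<m^{(a)}_i$: $\langle f,g\rangle_{\check u^{(1)}}=\langle u,\frac f{L^{(1)}}\otimes\bar g\rangle+\sum_{i,r}\frac1{r!}f^{(r)}(\zeta^{(1)}_i)\overline{\langle\xi^{(1)}_{i,r},g\rangle}$, $\langle f,g\rangle_{\check u^{(2)}}=\langle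 u,f\otimes\overline{g/L^{(2)}}\rangle+\sum_{i,r}\frac1{r!}\langle\xi^{(2)}_{i,r},f\rangle\overline{g^{(r)}(\zeta^{(2)}_i)}$. Objects $\check S^{(a)}_b,\check H^{(a)}_k,\check\phi^{(a)}_{b,k},\check C^{(a)}_{b,k},\check K^{(a),[l]}_{C,\phi},\check K^{(a),[l]}_{\phi,C}$ are those associated in the same way with $\check u^{(a)}$. $\Omega^{(1)}_2[\underline n,l]$ and $\Omega^{(2)}_1[\underline n,l]$ are the $2\underline n\times2\underline n$ (upper triangular) submatrices of $\Omega^{(1)}_2$, resp. $\Omega^{(2)}_1$, with rows $l,\dots,l+2\underline n-1$ and columns $l-2\underline n,\dots,l-1$; $\check H^{(a)}[\underline n,l]=\operatorname{diag}(\check H^{(a)}_l,\dots,\check H^{(a)}_{l+2\underline n-1})$. *)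

(* Defs.v *)
(* MathComp / MathComp-Analysis. *)
From HB Require Import structures.
From mathcomp Require Import all_boot all_order all_algebra.
From mathcomp Require Import all_classical all_reals all_analysis.
From mathcomp Require Import complex.

Set Implicit Arguments.
Unset Strict Implicit.
Unset Printing Implicit Defensive.

Import Order.TTheory GRing.Theory Num.Theory.
Import numFieldNormedType.Exports.

Local Open Scope classical_set_scope.
Local Open Scope ring_scope.

(* The ascription to numClosedFieldType equips R[i] with the topology of its
   norm and makes _^* the complex conjugation. *)
Definition Cplx (R : realType) : numClosedFieldType := R[i].

Section LaurentPolynomials.
Variable R : realType.
Local Notation C := (Cplx R).

(* L(z) = L_n z^n + ... + L_{-m} z^{-m}, given by its coefficients; only the
   values of L on {-m, ..., n} matter. *)
Definition laurent (n m : nat) (L : int -> C) (z : C) : C :=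
  \sum_(0 <= k < (n + m).+1) L (k%:Z - m%:Z) * z ^ (k%:Z - m%:Z).

Definition laurent_deriv (n m : nat) (L : int -> C) (z : C) : C :=
  \sum_(0 <= k < (n + m).+1)
    L (k%:Z - m%:Z) * (k%:Z - m%:Z)%:~R * z ^ (k%:Z - m%:Z - 1).

(* The difference quotient, which is a Laurent polynomial in (x, y); its value
   on the diagonal is L'(x). *)
Definition delta (n m : nat) (L : int -> C) (x y : C) : C :=
  if x == y then laurent_deriv n m L x
  else (laurent n m L x - laurent n m L y) / (x - y).

Definition laurent_bar (L : int -> C) : int -> C := fun k => (L k)^*.

Lemma laurent_barE n m L z :
  laurent n m (laurent_bar L) z = (laurent n m L z^*)^*.
Proof.
rewrite /laurent rmorph_sum; apply: eq_bigr => k _ /=.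
by rewrite rmorphM /= fmorphXz /= conjCK.
Qed.

(* chi = [1, z^-1, z, z^-2, z^2, ...]^T *)
Definition chi (k : nat) (z : C) : C :=
  if odd k then z ^- k.+1./2 else z ^+ k./2.

(* f is, on C \ {0}, a rational function whose nonzero poles lie outside A.
   Its values at 0 and at the poles are left unconstrained. *)
Definition rational_off (A : set C) (f : C -> C) : Prop :=
  exists p q : {poly C},
    [/\ q != 0,
        forall z, z != 0 -> A z -> q.[z] != 0 &
        forall z, z != 0 -> q.[z] != 0 -> f z = p.[z] / q.[z]].

End LaurentPolynomials.

Section BivariateFunctionals.
Variable R : realType.
Local Notation C := (Cplx R).

Definition cstar2 : set (C * C) := [set z | z.1 != 0 /\ z.2 != 0].

(* f(z_1) (x) conj(g(z_2)) *)
Definition tensor (f g : C -> C) : C * C -> C := fun z => f z.1 * (g z.2)^*.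

(* A is a relatively closed subset of C^* x C^*, and v kills every test
   function vanishing on a neighbourhood of A. *)
Definition carrier (T : Type) (ev : T -> C * C -> C) (v : T -> C)
    (A : set (C * C)) : Prop :=
  [/\ A `<=` cstar2, closure A `&` cstar2 `<=` A &
      forall t : T,
        (exists U : set (C * C),
           [/\ open U, A `<=` U & forall z, U z -> ev t z = 0]) -> v t = 0].

Definition support (T : Type) (ev : T -> C * C -> C) (v : T -> C)
  : set (C * C) :=
  \bigcap_(A in [set A | carrier ev v A]) A.

(* A test function t is realized as the function ev t. Test functions need
   only make sense near the support, so ev t may take arbitrary values away
   from it (e.g. at the poles of a rational function). The support is well
   defined when the intersection of all carriers is itself a carrier. *)
Record bifunctional : Type := Bifunctional {
  test_space : topologicalLmodType C;
  ev : test_space -> C * C -> C;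
  bval : test_space -> C;
  ev_linear : forall (a : C) (s t : test_space) (z : C * C),
    ev (a *: s + t) z = a * ev s z + ev t z;
  ev_inj : injective ev;
  bval_linear : forall (a : C) (s t : test_space),
    bval (a *: s + t) = a * bval s + bval t;
  bval_continuous : continuous bval;
  support_well_defined : carrier ev bval (support ev bval);
  rational_test : forall f g : C -> C,
    rational_off (fst @` support ev bval) f ->
    rational_off (snd @` support ev bval) g ->
    exists t : test_space, ev t = tensor f g }.

Definition supp (v : bifunctional) : set (C * C) := support (@ev v) (@bval v).
Definition supp1 (v : bifunctional) : set C := fst @` supp v.
Definition supp2 (v : bifunctional) : set C := snd @` supp v.

(* <f, g>_v, i.e. the value of v at the unique test function realized by
   f (x) conj(g); junk if there is none. *)
Definition bpair (v : bifunctional) (f g : C -> C) : C :=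
  bval (xget 0 [set t : test_space v | ev t = tensor f g]).

(* L(z_1) v' = v *)
Definition geronimus1 (L : C -> C) (v v' : bifunctional) : Prop :=
  forall f g : C -> C,
    rational_off (supp1 v `|` supp1 v') f ->
    rational_off (supp2 v `|` supp2 v') g ->
    bpair v' (fun z => L z * f z) g = bpair v f g.

(* v' conj(L(z_2)) = v *)
Definition geronimus2 (L : C -> C) (v v' : bifunctional) : Prop :=
  forall f g : C -> C,
    rational_off (supp1 v `|` supp1 v') f ->
    rational_off (supp2 v `|` supp2 v') g ->
    bpair v' f (fun z => L z * g z) = bpair v f g.

End BivariateFunctionals.

Section SemiInfiniteMatrices.
Variable R : realType.
Local Notation C := (Cplx R).
Local Notation imx := (nat -> nat -> C).

Definition lower_unitriangular (A : imx) : Prop :=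
  (forall i, A i i = 1) /\ (forall i j, (i < j)%N -> A i j = 0).

(* The product A B for a lower triangular A, for which row i stops at
   column i. *)
Definition lmul (A B : imx) : imx :=
  fun i j => \sum_(k < i.+1) A i k * B k j.

(* The inverse of a lower unitriangular A: row i is the last row of the
   inverse of the leading (i+1) x (i+1) truncation. *)
Definition linv (A : imx) : imx := fun i j =>
  if (j <= i)%N
  then invmx (\matrix_(p < i.+1, q < i.+1) A p q) ord_max (inord j)
  else 0.

Definition idiag (H : nat -> C) : imx := fun i j => if i == j then H i else 0.

Definition idag (A : imx) : imx := fun i j => (A j i)^*.

Definition quasidefinite (G : imx) : Prop :=
  forall k : nat, \det (\matrix_(i < k.+1, j < k.+1) G i j) != 0.

Record gauss_borel (G : imx) : Type := GaussBorel {
  gbS1 : imx;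
  gbS2 : imx;
  gbH : nat -> C;
  gbS1_unitri : lower_unitriangular gbS1;
  gbS2_unitri : lower_unitriangular gbS2;
  gbH_neq0 : forall k, gbH k != 0;
  gbE : forall i j,
    G i j = lmul (linv gbS1) (lmul (idiag gbH) (idag (linv gbS2))) i j }.

Lemma linv_low (A : imx) i j : (i < j)%N -> linv A i j = 0.
Proof. by move=> ij; rewrite /linv leqNgt ij. Qed.

Lemma lmul_linvl (A : imx) : lower_unitriangular A ->
  forall i j, lmul (linv A) A i j = (i == j)%:R.
Proof.
move=> [A1 A0] i j; have [ij|ji] := ltnP i j.
  rewrite /lmul big1 ?(ltn_eqF ij)// => k _.
  by rewrite (A0 k j) ?mulr0// (leq_ltn_trans _ ij)// -ltnS.
set M : 'M[C]_i.+1 := \matrix_(p < i.+1, q < i.+1) A p q.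
have uM : M \in unitmx.
  rewrite unitmxE det_trig; last first.
    by apply/is_trig_mxP => p q pq; rewrite mxE A0.
  by rewrite big1 ?unitr1// => p _; rewrite mxE A1.
have := congr1 (fun N : 'M[C]_i.+1 => N ord_max (inord j)) (mulVmx uM).
rewrite !mxE -val_eqE /= inordK ?ltnS// => <-.
apply: eq_bigr => k _; rewrite /linv -ltnS ltn_ord mxE inordK ?ltnS//.
by rewrite inord_val.
Qed.

Section Blocks.
Local Open Scope nat_scope.

Definition seg_row (N : nat) (f : nat -> C) (l : nat) : 'rV[C]_(2 * N) :=
  \row_(i < 2 * N) f (l + i).

Definition seg_col (N : nat) (f : nat -> C) (l : nat) : 'cV[C]_(2 * N) :=
  \col_(i < 2 * N) f (l + i).

Definition seg_diag (N : nat) (H : nat -> C) (l : nat) : 'M[C]_(2 * N) :=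
  diag_mx (seg_row N H l).

(* Rows l, ..., l+2N-1 and columns l-2N, ..., l-1, for 2N <= l. *)
Definition Omega_block (N : nat) (Om : imx) (l : nat) : 'M[C]_(2 * N) :=
  \matrix_(i < 2 * N, j < 2 * N) Om (l + i) (l - 2 * N + j).

End Blocks.
End SemiInfiniteMatrices.

Section Biorthogonality.
Variable R : realType.
Local Notation C := (Cplx R).

Definition gram (v : bifunctional R) : nat -> nat -> C :=
  fun k l => bpair v (@chi R k) (@chi R l).

Variables (v : bifunctional R) (F : gauss_borel (gram v)).

Definition phi1 (k : nat) (z : C) : C := \sum_(j < k.+1) gbS1 F k j * chi j z.
Definition phi2 (k : nat) (z : C) : C := \sum_(j < k.+1) gbS2 F k j * chi j z.

(* Meaningful when z^* is not in supp2 v. *)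
Definition C1 (k : nat) (z : C) : C :=
  bpair v (phi1 k) (fun z2 => (z^* - z2)^-1).

(* Meaningful when z^* is not in supp1 v. *)
Definition C2 (k : nat) (z : C) : C :=
  (bpair v (fun z1 => (z^* - z1)^-1) (phi2 k))^*.

(* The first argument of the kernels is the conjugate y1 of x1. *)
Definition K_Cphi (l : nat) (y1 x2 : C) : C :=
  \sum_(k < l) (C2 k y1^*)^* * (gbH F k)^-1 * phi1 k x2.

Definition K_phiC (l : nat) (y1 x2 : C) : C :=
  \sum_(k < l) (phi2 k y1^*)^* * (gbH F k)^-1 * C1 k x2.

End Biorthogonality.

(* Main.v *)
Require Import Defs.
From HB Require Import structures.
From mathcomp Require Import all_boot all_order all_algebra.
From mathcomp Require Import all_classical all_reals all_analysis.
From mathcomp Require Import complex.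
From mathcomp Require Import ring zify.

Set Implicit Arguments.
Unset Strict Implicit.
Unset Printing Implicit Defensive.

Import Order.TTheory GRing.Theory Num.Theory.
Import numFieldNormedType.Exports.

Local Open Scope classical_set_scope.
Local Open Scope ring_scope.

(** The Geronimus relation says that multiplication by [L := L1] in the first
    variable carries the checked functional [u1] back to [u].  Two expansions
    follow.  By its very definition the connection matrix
    Om = S2' S2^-1 (primes for the checked objects) gives
        phi2'_k = sum_(j <= k) Om_kj phi2_j,
    and by biorthogonality the coefficients of [L phi1_j] on the phi1' are
        < L phi1_j, phi2'_k >_u1 / H'_k = < phi1_j, phi2'_k >_u / H'_k
                                        = conj(Om_kj) H_j / H'_k.
    As [L phi1_j] is a combination of the first j + 1 + 2 max(n, m) terms of
    chi, the matrix Om vanishes unless j <= k <= j + 2 max(n, m)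
    ([connection_band]).

    Expanding the factors with index k < l of one kernel by the first relation
    and the factors with index j < l of the other by the second one yields the
    same band-limited double sum, cut off at k < l in one case and at j < l in
    the other.  The difference is the corner j < l <= k of the band, which is
    the block of Om on the right-hand sides ([band_corner]).

    This is the whole argument when the Cauchy factor 1 / (conj x2 - z2) sits
    in the second variable, where [L] does not act
    ([geronimus_kernel_cauchy_right]).  When the Cauchy factor
    1 / (conj x1 - z1) sits in the first one, the identity
        L(x) / (x - z) = delta L(x, z) + L(z) / (x - z)
    produces an extra term, the pairing of delta L(x, .) with the phi2'_k.
    Since delta L(x, .) only involves the first 2 max(n, m) <= l terms of chi,
    the Christoffel-Darboux kernel reproduces it, whence the isolated term
    delta L ([geronimus_kernel_cauchy_left]).

    The transformation in the second variable reduces to that in the first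
    one by transposing the pairing, (f, g) |-> conj < g, f >.  This exchanges
    phi1 with phi2, C1 with C2 and S1 with S2.  For this reason the argument is
    carried out for abstract sesquilinear pairings of rational functions rather
    than for functionals on a space of test functions. *)

(** * Rational test functions *)
Section RationalFunctions.
Variable R : realType.
Local Notation C := (Cplx R).
Implicit Types (A B : set C) (f g : C -> C) (e : int).

Lemma rational_off_mul A f g :
  rational_off A f -> rational_off A g -> rational_off A (fun z => f z * g z).
Proof.
move=> [p [q [q0 qA fE]]] [p' [q' [q'0 q'A gE]]].
exists (p * p'), (q * q'); split; first by rewrite mulf_neq0.
  by move=> z z0 Az; rewrite hornerM mulf_neq0 ?qA ?q'A.
move=> z z0; rewrite !hornerM mulf_eq0 negb_or => /andP[qz q'z].
by rewrite fE// gE// mulf_div.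
Qed.

Lemma rational_off_lin A a f g : rational_off A f -> rational_off A g ->
  rational_off A (fun z => a * f z + g z).
Proof.
move=> [p [q [q0 qA fE]]] [p' [q' [q'0 q'A gE]]].
exists (a *: (p * q') + p' * q), (q * q'); split; first by rewrite mulf_neq0.
  by move=> z z0 Az; rewrite hornerM mulf_neq0 ?qA ?q'A.
move=> z z0; rewrite !(hornerM, hornerD, hornerZ) mulf_eq0 negb_or.
by case/andP=> qz q'z; rewrite fE// gE// mulrA addf_div// mulrA.
Qed.

Lemma rational_off_exp A e : rational_off A (fun z => z ^ e).
Proof.
case: e => k.
  exists 'X^k, 1; split; rewrite ?oner_neq0// => z *.
    by rewrite hornerC oner_neq0.
  by rewrite hornerXn hornerC divr1.
exists 1, 'X^(k.+1); split; rewrite ?monic_neq0 ?monicXn// => z z0 _.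
  by rewrite hornerXn expf_neq0.
by rewrite hornerXn hornerC mul1r.
Qed.

Lemma rational_off0 A : rational_off A (fun=> 0).
Proof.
exists 0, 1; split; rewrite ?oner_neq0// => z *; rewrite ?hornerC ?oner_neq0//.
by rewrite mul0r.
Qed.

Lemma rational_off_sum A (M : nat) (c : nat -> C) (f : nat -> C -> C) :
  (forall j, rational_off A (f j)) ->
  rational_off A (fun z => \sum_(j < M) c j * f j z).
Proof.
move=> fA; elim: M => [|M IH].
  by under eq_fun do rewrite big_ord0; exact: rational_off0.
under eq_fun do rewrite big_ord_recr /= addrC.
exact: rational_off_lin.
Qed.

Lemma rational_off_cauchy A x : ~ A x -> rational_off A (fun z => (x - z)^-1).
Proof.
move=> Ax; exists 1, (x%:P - 'X); split.
- by rewrite -opprB oppr_eq0 polyXsubC_eq0.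
- move=> z _ Az; rewrite !hornerE subr_eq0; apply/eqP => xz.
  by apply: Ax; rewrite xz.
- by move=> z _ _; rewrite !hornerE ?mul1r.
Qed.

Lemma rational_off_laurent A n m (L : int -> C) :
  rational_off A (laurent n m L).
Proof.
rewrite (_ : laurent n m L = fun z => \sum_(k < (n + m).+1)
    L (k%:Z - m%:Z) * z ^ (k%:Z - m%:Z)); last first.
  by apply/funext => z; rewrite /laurent big_mkord.
apply: (@rational_off_sum A _ (fun k => L (k%:Z - m%:Z))
          (fun k z => z ^ (k%:Z - m%:Z))) => k.
exact: rational_off_exp.
Qed.

Definition chi_exp (k : nat) : int :=
  if odd k then - (k.+1./2)%:Z else (k./2)%:Z.

Lemma chiE k (z : C) : chi k z = z ^ chi_exp k.
Proof. by rewrite /chi /chi_exp; case: odd; rewrite ?NegzE -?invr_expz. Qed.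

Lemma rational_off_chi A k : rational_off A (@chi R k).
Proof.
rewrite (_ : @chi R k = fun z => z ^ chi_exp k); last exact/funext/chiE.
exact: rational_off_exp.
Qed.

End RationalFunctions.
#[local] Hint Resolve rational_off0 rational_off_chi rational_off_laurent
  : core.

(** * Sesquilinear pairings *)
Section Pairings.
Variable R : realType.
Local Notation C := (Cplx R).
Implicit Types (S T : set C) (f g : C -> C).

(** The properties of (f, g) |-> < f, g >_v on which the kernel identities
    rest, S and T being the projections of the support of v.  The point x of
    [pairing_eql] and [pairing_eqr] is there because products such as
    L(z) / (x - z) have a meaningless value at the pole x; at 0 the meaningless
    values are those of the Laurent monomials. *)
Record pairing S T (B : (C -> C) -> (C -> C) -> C) : Prop := Pairing {
  pairing_off0l : ~ S 0;
  pairing_off0r : ~ T 0;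
  pairing_linl : forall a f f' g,
    rational_off S f -> rational_off S f' -> rational_off T g ->
    B (fun z => a * f z + f' z) g = a * B f g + B f' g;
  pairing_linr : forall a f g g',
    rational_off S f -> rational_off T g -> rational_off T g' ->
    B f (fun z => a * g z + g' z) = a^* * B f g + B f g';
  pairing_eql : forall x f f' g,
    rational_off S f -> rational_off S f' -> rational_off T g -> ~ S x ->
    (forall z, z != 0 -> z != x -> f z = f' z) -> B f g = B f' g;
  pairing_eqr : forall x f g g',
    rational_off S f -> rational_off T g -> rational_off T g' -> ~ T x ->
    (forall z, z != 0 -> z != x -> g z = g' z) -> B f g = B f g' }.

Definition flip (B : (C -> C) -> (C -> C) -> C) f g : C := (B g f)^*.

Lemma flip_pairing S T B : pairing S T B -> pairing T S (flip B).
Proof.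
move=> [S0 T0 Bl Br Bel Ber]; split; rewrite /flip//.
- by move=> a f f' g Tf Tf' Sg; rewrite Br// rmorphD rmorphM /= conjCK.
- by move=> a f g g' Tf Sg Sg'; rewrite Bl// rmorphD rmorphM.
- by move=> x f f' g Tf Tf' Sg Tx ff'; rewrite (Ber x g f f').
- by move=> x f g g' Tf Sg Sg' Sx gg'; rewrite (Bel x g g' f).
Qed.

Section Sums.
Variables (S T : set C) (B : (C -> C) -> (C -> C) -> C).
Hypothesis HB : pairing S T B.

Lemma pairing0l g : rational_off T g -> B (fun=> 0) g = 0.
Proof.
move=> Tg; have := pairing_linl HB (-1) (rational_off0 S) (rational_off0 S) Tg.
rewrite (_ : (fun z => -1 * 0 + 0) = fun=> 0); last first.
  by apply/funext => z; rewrite mulr0 addr0.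
by rewrite mulN1r addNr.
Qed.

Lemma pairing_suml M (c : nat -> C) (f : nat -> C -> C) g :
  (forall j, rational_off S (f j)) -> rational_off T g ->
  B (fun z => \sum_(j < M) c j * f j z) g = \sum_(j < M) c j * B (f j) g.
Proof.
move=> Sf Tg; elim: M => [|M IH].
  rewrite big_ord0 -[RHS](pairing0l Tg); congr (B _ _).
  by apply/funext => z; rewrite big_ord0.
rewrite big_ord_recr /= -IH addrC -(pairing_linl HB)//; last first.
  exact: rational_off_sum.
by congr (B _ _); apply/funext => z; rewrite big_ord_recr /= addrC.
Qed.

End Sums.

Lemma pairing_sumr S T B M (c : nat -> C) f (g : nat -> C -> C) :
  pairing S T B -> rational_off S f -> (forall j, rational_off T (g j)) ->
  B f (fun z => \sum_(j < M) c j * g j z) = \sum_(j < M) (c j)^* * B f (g j).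
Proof.
move=> /flip_pairing HB Sf Tg; apply: (can_inj (@conjCK C)).
rewrite -[LHS]/(flip B _ f) (pairing_suml HB)// rmorph_sum.
by apply: eq_bigr => j _; rewrite rmorphM /= conjCK.
Qed.

End Pairings.

Section FunctionalPairing.
Variables (R : realType) (v : bifunctional R).
Local Notation C := (Cplx R).
Implicit Types (f g : C -> C).

Lemma bpairE (t : test_space v) f g : ev t = tensor f g -> bpair v f g = bval t.
Proof.
move=> tE; rewrite /bpair (@xget_unique _ _ _ t)// => s /= sE.
by apply: ev_inj; rewrite sE tE.
Qed.

Lemma supp_cstar : supp v `<=` @cstar2 R.
Proof. by case: (support_well_defined v). Qed.

(** The hyperplanes z1 = 0, z1 = x1, z2 = 0 and z2 = x2 are closed and miss the
    support, so that their complement is a neighbourhood of it. *)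
Lemma bval_eq (x1 x2 : C) (s t : test_space v) : ~ supp1 v x1 -> ~ supp2 v x2 ->
  (forall z, z.1 != 0 -> z.2 != 0 -> z.1 != x1 -> z.2 != x2 ->
     ev s z = ev t z) -> bval s = bval t.
Proof.
move=> vx1 vx2 st; apply/eqP; rewrite -subr_eq0 -mulN1r addrC -bval_linear.
apply/eqP; have [_ _ kill] := support_well_defined v; apply: kill.
pose away (a : C) : set C := ~` [set a].
have aO a : open (away a).
  apply/closed_openC; apply: accessible_closed_set1.
  exact/hausdorff_accessible/norm_hausdorff.
have fO a : open ((fun z : C * C => z.1) @^-1` away a).
  by apply: open_comp => // z _; exact: cvg_fst.
have sO a : open ((fun z : C * C => z.2) @^-1` away a).
  by apply: open_comp => // z _; exact: cvg_snd.
exists ((fst @^-1` away 0 `&` fst @^-1` away x1) `&`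
        (snd @^-1` away 0 `&` snd @^-1` away x2)); split.
- by apply: openI; apply: openI.
- move=> z vz; have [/eqP z1 /eqP z2] := supp_cstar vz.
  split; split=> //= zE.
    by apply: vx1; exists z.
  by apply: vx2; exists z.
- move=> z [[/= z10 z11] [z20 z21]]; rewrite ev_linear st ?mulN1r ?addNr//;
  exact/eqP.
Qed.

Lemma supp1_0 : ~ supp1 v 0.
Proof. by case=> z /supp_cstar[/eqP]. Qed.

Lemma supp2_0 : ~ supp2 v 0.
Proof. by case=> z /supp_cstar[_ /eqP]. Qed.

Lemma bpair_pairing : pairing (supp1 v) (supp2 v) (bpair v).
Proof.
split; [exact: supp1_0 | exact: supp2_0 | | | |].
- move=> a f f' g vf vf' vg; have [t tE] := rational_test vf vg.
  have [t' t'E] := rational_test vf' vg.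
  rewrite (bpairE tE) (bpairE t'E) -bval_linear; apply: bpairE.
  by apply/funext => z; rewrite ev_linear tE t'E /tensor mulrDl mulrA.
- move=> a f g g' vf vg vg'; have [t tE] := rational_test vf vg.
  have [t' t'E] := rational_test vf vg'.
  rewrite (bpairE tE) (bpairE t'E) -bval_linear; apply: bpairE.
  apply/funext => z; rewrite ev_linear tE t'E /tensor rmorphD rmorphM /=; ring.
- move=> x f f' g vf vf' vg vx ff'; have [t tE] := rational_test vf vg.
  have [t' t'E] := rational_test vf' vg.
  rewrite (bpairE tE) (bpairE t'E).
  apply: (bval_eq vx supp2_0) => z z1 z2 z1x _.
  by rewrite tE t'E /tensor ff'.
- move=> x f g g' vf vg vg' vx gg'; have [t tE] := rational_test vf vg.
  have [t' t'E] := rational_test vf vg'.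
  rewrite (bpairE tE) (bpairE t'E).
  apply: (bval_eq supp1_0 vx) => z z1 z2 _ z2x.
  by rewrite tE t'E /tensor gg'.
Qed.

End FunctionalPairing.

(** * Laurent polynomials in the span of an initial segment of chi *)
Section ChiSpan.
Variable R : realType.
Local Notation C := (Cplx R).
Implicit Types (f g : C -> C) (L : int -> C) (e : int).

Definition chi_span (M : nat) f : Prop :=
  exists c : nat -> C, forall z, z != 0 -> f z = \sum_(j < M) c j * chi j z.

Lemma chi_span_rational A M f : chi_span M f -> rational_off A f.
Proof.
move=> [c fE]; have [p [q [q0 qA sE]]] :
    rational_off A (fun z => \sum_(j < M) c j * chi j z).
  exact: (@rational_off_sum _ A M c (@chi R)).
by exists p, q; split=> // z z0 qz; rewrite fE// sE.
Qed.

Lemma chi_span_lin M a f g :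
  chi_span M f -> chi_span M g -> chi_span M (fun z => a * f z + g z).
Proof.
move=> [c fE] [d gE]; exists (fun j => a * c j + d j) => z z0.
rewrite fE// gE// mulr_sumr -big_split; apply: eq_bigr => j _ /=.
by rewrite mulrDl mulrA.
Qed.

Lemma chi_span_sum M (c : nat -> C) (f : nat -> C -> C) K :
  (forall k, (k < K)%N -> chi_span M (f k)) ->
  chi_span M (fun z => \sum_(k < K) c k * f k z).
Proof.
elim: K => [|K IH] fM.
  by exists (fun=> 0) => z _; rewrite big_ord0 big1// => j _; rewrite mul0r.
under eq_fun do rewrite big_ord_recr /= addrC.
by apply: chi_span_lin; [exact: fM | apply: IH => k kK; apply: fM; exact: ltnW].
Qed.

Lemma chi_span_eq M f g :
  (forall z, z != 0 -> f z = g z) -> chi_span M f -> chi_span M g.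
Proof. by move=> fg [c fE]; exists c => z z0; rewrite -fg// fE. Qed.

Lemma chi_exp_bounds k : 2 * chi_exp k <= k%:Z /\ - 2 * chi_exp k <= k.+1%:Z.
Proof. by rewrite /chi_exp; case: ifP => ko; split; lia. Qed.

Lemma chi_span_exp M e :
  2 * e < M%:Z -> - 2 * e <= M%:Z -> chi_span M (fun z => z ^ e).
Proof.
move=> eM eM'; have [k kM eE] : exists2 k, (k < M)%N & e = chi_exp k.
  case: e eM eM' => e eM eM'.
    exists (2 * e)%N; first lia.
    by rewrite /chi_exp mul2n odd_double doubleK.
  exists (2 * e + 1)%N; first lia.
  by rewrite /chi_exp; case: ifP; lia.
exists (fun j => (j == k)%:R) => z z0.
rewrite (bigD1 (Ordinal kM))//= eqxx mul1r big1 ?addr0 ?chiE ?eE// => j jk.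
by move: jk; rewrite -val_eqE /= => /negPf ->; rewrite mul0r.
Qed.

(** In chi the exponents -k and k stand at positions 2k - 1 and 2k, so that
    shifting an exponent by i moves its position by at most 2 |i|. *)
Lemma laurent_chi_span n m L M f :
  chi_span M f ->
  chi_span (M + 2 * maxn n m) (fun z => laurent n m L z * f z).
Proof.
move=> [c fE].
pose F (k : nat) (z : C) := z ^ (k%:Z - m%:Z) * \sum_(j < M) c j * chi j z.
apply: (@chi_span_eq _
    (fun z => \sum_(k < (n + m).+1) L (k%:Z - m%:Z) * F k z)).
  move=> z z0; rewrite /laurent big_mkord mulr_suml; apply: eq_bigr => k _.
  by rewrite /F -fE// mulrA.
apply: (chi_span_sum (fun k => L (k%:Z - m%:Z)) (f := F)) => k knm.
apply: (@chi_span_eq _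
    (fun z => \sum_(j < M) c j * z ^ (k%:Z - m%:Z + chi_exp j))).
  move=> z z0; rewrite /F mulr_sumr; apply: eq_bigr => j _.
  by rewrite chiE expfzDr// mulrCA.
apply: (chi_span_sum c (f := fun j z => z ^ (k%:Z - m%:Z + chi_exp j))) => j jM.
by have [j1 j2] := chi_exp_bounds j; apply: chi_span_exp; lia.
Qed.

(** The difference quotient of a monomial as a Laurent polynomial; its value
    on the diagonal is the derivative, so that [delta] is the same Laurent
    polynomial on and off the diagonal. *)
Definition delta_exp e (x y : C) : C :=
  match e with
  | Posz k => \sum_(i < k) x ^+ (k.-1 - i) * y ^ i%:Z
  | Negz k => - \sum_(i < k.+1) x ^ (- i%:Z - 1) * y ^ (i%:Z - k.+1%:Z)
  end.

Lemma delta_expE e (x y : C) : x != 0 -> y != 0 -> 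
  delta_exp e x y =
    if x == y then e%:~R * x ^ (e - 1) else (x ^ e - y ^ e) / (x - y).
Proof.
move=> x0 y0; case: eqP => [<-|/eqP xy]; case: e => k /=.
- case: k => [|k]; first by rewrite big_ord0 mul0r.
  rewrite (eq_bigr (fun=> x ^+ k)) => [|i _].
    by rewrite sumr_const card_ord -mulr_natl (_ : k.+1%:Z - 1 = k)//; lia.
  by rewrite -exprnP -exprD subnK// -ltnS.
- rewrite (eq_bigr (fun=> x ^ (Negz k - 1))) => [|i _].
    by rewrite sumr_const card_ord -mulr_natl NegzE mulrNz mulNr.
  by rewrite -expfzDr//; congr (_ ^ _); rewrite NegzE; lia.
- have xy0 : x - y != 0 by rewrite subr_eq0.
  by rewrite -!exprnP subrXX mulrAC divff// mul1r.
- have xy0 : x - y != 0 by rewrite subr_eq0.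
  have xk : x ^+ k.+1 != 0 by rewrite expf_neq0.
  have yk : y ^+ k.+1 != 0 by rewrite expf_neq0.
  have -> : x ^ Negz k - y ^ Negz k =
      - (x ^+ k.+1 - y ^+ k.+1) / (x ^+ k.+1 * y ^+ k.+1).
    by rewrite /exprz; field; rewrite xk yk.
  rewrite subrXX; set s := \sum_(i < _) _.
  set t := \sum_(i < _) _.
  have -> : t = s * (x ^+ k.+1 * y ^+ k.+1).
    rewrite /s mulr_suml; apply: eq_bigr => i _.
    rewrite mulrACA !exprnP -!expfzDr//; congr (_ ^ _ * _ ^ _).
      by have := ltn_ord i; lia.
    lia.
  by field; rewrite xy0 xk yk.
Qed.

Lemma deltaE n m L (x y : C) : x != 0 -> y != 0 ->
  delta n m L x y =
  \sum_(k < (n + m).+1) L (k%:Z - m%:Z) * delta_exp (k%:Z - m%:Z) x y.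
Proof.
move=> x0 y0; rewrite /delta; case: ifPn => xy.
  rewrite /laurent_deriv big_mkord; apply: eq_bigr => k _.
  by rewrite delta_expE// xy mulrA.
rewrite /laurent !big_mkord -sumrB mulr_suml; apply: eq_bigr => k _.
by rewrite delta_expE// (negPf xy) -mulrBr mulrA.
Qed.

(** The exponents of y in the difference quotient run from -m to n - 1.  The
    exponent n, which stands at position 2n, is absent, so that 2 max(n, m)
    terms of chi suffice. *)
Lemma delta_chi_span n m L (x : C) :
  x != 0 -> chi_span (2 * maxn n m) (delta n m L x).
Proof.
move=> x0; apply: (@chi_span_eq _ (fun y => \sum_(k < (n + m).+1)
    L (k%:Z - m%:Z) * delta_exp (k%:Z - m%:Z) x y)).
  by move=> y y0; rewrite deltaE.
apply: (chi_span_sum (fun k => L (k%:Z - m%:Z))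
          (f := fun k y => delta_exp (k%:Z - m%:Z) x y)) => k knm.
case E : (k%:Z - m%:Z) => [e|e] /=.
  apply: (chi_span_sum (fun i => x ^+ (e.-1 - i))
            (f := fun i y => y ^ i%:Z)) => i ie.
  by apply: chi_span_exp; lia.
apply: (@chi_span_eq _ (fun y => \sum_(i < e.+1)
    - x ^ (- i%:Z - 1) * y ^ (i%:Z - e.+1%:Z))).
  by move=> y _; rewrite -sumrN; apply: eq_bigr => i _; rewrite mulNr.
apply: (chi_span_sum (fun i => - x ^ (- i%:Z - 1))
          (f := fun i y => y ^ (i%:Z - e.+1%:Z))) => i ie.
by apply: chi_span_exp; lia.
Qed.

Lemma delta_cauchy n m L (x z : C) : z != x ->
  laurent n m L x * (x - z)^-1 =
  delta n m L x z + laurent n m L z * (x - z)^-1.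
Proof.
by move=> zx; rewrite /delta eq_sym (negPf zx) -mulrDl subrK.
Qed.

Lemma conj_delta n m L (x y : C) : x != 0 -> y != 0 ->
  (delta n m L x y)^* = delta n m (laurent_bar L) y^* x^*.
Proof.
move=> x0 y0; rewrite /delta (inj_eq (can_inj (@conjCK C))) eq_sym.
case: eqP => [->|_].
  rewrite /laurent_deriv rmorph_sum; apply: eq_bigr => k _ /=.
  by rewrite !rmorphM /= fmorphXz rmorph_int.
rewrite !laurent_barE !conjCK fmorph_div !rmorphB /=.
by rewrite -[in RHS]mulrNN -invrN !opprB.
Qed.

End ChiSpan.

(** * Lower triangular semi-infinite matrices *)
Section Triangular.
Variable R : realType.
Local Notation C := (Cplx R).
Local Notation imx := (nat -> nat -> C).
Implicit Types (A B : imx) (f : nat -> C -> C).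

Definition row_comb A f (k : nat) (z : C) : C := \sum_(j < k.+1) A k j * f j z.

Lemma sum_widen (M k : nat) (F : nat -> C) :
  (k <= M)%N -> (forall j, (k <= j < M)%N -> F j = 0) ->
  \sum_(j < k) F j = \sum_(j < M) F j.
Proof.
move=> kM F0; rewrite -!(big_mkord xpredT F) [RHS](@big_cat_nat _ _ _ k)//=.
rewrite [X in _ + X]big1_seq ?addr0// => j /andP[_].
by rewrite mem_index_iota; exact: F0.
Qed.

Lemma sum_lower A (M k : nat) (b : nat -> C) :
  (forall i j, (i < j)%N -> A i j = 0) -> (k < M)%N ->
  \sum_(j < k.+1) A k j * b j = \sum_(j < M) A k j * b j.
Proof.
move=> A0 kM; rewrite (sum_widen (F := fun j => A k j * b j) kM)//.
by move=> j /andP[kj _]; rewrite A0 ?mul0r.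
Qed.

Lemma row_comb_comp A B f k z : (forall i j, (i < j)%N -> B i j = 0) ->
  row_comb A (row_comb B f) k z = row_comb (lmul A B) f k z.
Proof.
move=> B0; rewrite /row_comb /lmul.
under [RHS]eq_bigr do rewrite mulr_suml.
rewrite exchange_big /=; apply: eq_bigr => j _ /=.
rewrite (@sum_lower B k.+1 j (fun i => f i z))// mulr_sumr.
by apply: eq_bigr => i _; rewrite mulrA.
Qed.

Lemma row_comb_linv A f k z : lower_unitriangular A ->
  row_comb (linv A) (row_comb A f) k z = f k z.
Proof.
move=> Au; rewrite row_comb_comp ?/row_comb; last by case: Au.
rewrite (bigD1 ord_max)//= lmul_linvl// eqxx mul1r big1 ?addr0// => j jk.
by rewrite lmul_linvl// eq_sym (negPf (_ : (j : nat) != k)) ?mul0r.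
Qed.

(** A left inverse of a finite square matrix is a right inverse, and leading
    truncation is multiplicative on lower triangular matrices. *)
Lemma lmul_linvr A : lower_unitriangular A ->
  forall i j, lmul A (linv A) i j = (i == j)%:R.
Proof.
move=> Au i j; set M := (maxn i j).+1.
have [iM jM] : (i < M)%N /\ (j < M)%N by rewrite /M !ltnS leq_maxl leq_maxr.
pose P : 'M[C]_M := \matrix_(p, q) linv A p q.
pose Q : 'M[C]_M := \matrix_(p, q) A p q.
have PQ : P *m Q = 1%:M.
  apply/matrixP => p q; rewrite !mxE -[RHS](lmul_linvl Au p q) /lmul.
  rewrite (@sum_lower (linv A) M p (A^~ q))//; last exact: linv_low.
  by apply: eq_bigr => k _; rewrite !mxE.
have := congr1 (fun N : 'M[C]_M => N (Ordinal iM) (Ordinal jM)) (mulmx1C PQ).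
rewrite !mxE -val_eqE /= => <-.
rewrite /lmul (@sum_lower A M i ((linv A)^~ j))//; last by case: Au.
by apply: eq_bigr => k _; rewrite !mxE.
Qed.

Lemma row_comb_linvr A f k z : lower_unitriangular A ->
  row_comb A (row_comb (linv A) f) k z = f k z.
Proof.
move=> Au; rewrite row_comb_comp ?/row_comb; last exact: linv_low.
rewrite (bigD1 ord_max)//= lmul_linvr// eqxx mul1r big1 ?addr0// => j jk.
by rewrite lmul_linvr// eq_sym (negPf (_ : (j : nat) != k)) ?mul0r.
Qed.

Lemma lmul_low A B i j :
  (forall i j, (i < j)%N -> B i j = 0) -> (i < j)%N -> lmul A B i j = 0.
Proof.
move=> B0 ij; rewrite /lmul big1// => k _.
by rewrite B0 ?mulr0// (leq_ltn_trans _ ij)// -ltnS.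
Qed.

(** Both sums run over the band j <= k <= j + w.  Cutting it at k < l or at
    j < l only differs by the entries with j < l <= k, and these lie in the
    square of rows l, ..., l + w - 1 and columns l - w, ..., l - 1. *)
Lemma band_corner A (a b : nat -> C) (w l : nat) :
  (forall k j, (k < j)%N -> A k j = 0) ->
  (forall k j, (j + w < k)%N -> A k j = 0) -> (w <= l)%N ->
  \sum_(k < l) a k * \sum_(j < k.+1) A k j * b j
  - \sum_(j < l) (\sum_(k < (j + w).+1) a k * A k j) * b j
  = - \sum_(i < w) \sum_(j < w)
        a (l + i)%N * A (l + i)%N (l - w + j)%N * b (l - w + j)%N.
Proof.
move=> A0 Aw wl.
have -> : \sum_(k < l) a k * \sum_(j < k.+1) A k j * b j =
    \sum_(k < l) \sum_(j < l) a k * A k j * b j.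
  apply: eq_bigr => k _; rewrite (@sum_lower A l k b)// mulr_sumr.
  by apply: eq_bigr => j _; rewrite mulrA.
have -> : \sum_(j < l) (\sum_(k < (j + w).+1) a k * A k j) * b j =
    \sum_(k < l + w) \sum_(j < l) a k * A k j * b j.
  rewrite exchange_big; apply: eq_bigr => j _ /=; rewrite -mulr_suml.
  congr (_ * _); apply: (sum_widen (F := fun k => a k * A k j)).
    by rewrite -addSn leq_add2r.
  by move=> k /andP[jk _]; rewrite Aw ?mulr0.
rewrite big_split_ord /= opprD addrA subrr add0r; congr (- _).
apply: eq_bigr => i _.
rewrite -[in LHS](big_mkord xpredT
  (fun j => a (l + i)%N * A (l + i)%N j * b j)).
rewrite (@big_cat_nat _ _ _ (l - w))//= ?leq_subr//.
rewrite big1_seq ?add0r; last first.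
  move=> j /andP[_]; rewrite mem_index_iota => /andP[_ jl].
  by rewrite Aw ?mulr0 ?mul0r//; lia.
rewrite -{1}[(l - w)%N]add0n big_addn subKn// big_mkord.
by apply: eq_bigr => j _; rewrite [(j + _)%N]addnC.
Qed.

End Triangular.

(** * Biorthogonal systems and their Geronimus transforms *)
Section Biorthogonal.
Variable R : realType.
Local Notation C := (Cplx R).
Local Notation imx := (nat -> nat -> C).
Local Notation chi := (@chi R).

Record biorthogonal (S T : set C) (B : (C -> C) -> (C -> C) -> C)
    (A1 A2 : imx) (h : nat -> C) : Prop := Biorthogonal {
  bi_pairing : pairing S T B;
  bi_unitri1 : lower_unitriangular A1;
  bi_unitri2 : lower_unitriangular A2;
  bi_neq0 : forall k, h k != 0;
  bi_orth : forall i j,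
    B (row_comb A1 chi i) (row_comb A2 chi j) = if i == j then h i else 0 }.

Lemma flip_biorthogonal S T B A1 A2 h : biorthogonal S T B A1 A2 h ->
  biorthogonal T S (flip B) A2 A1 (fun k => (h k)^*).
Proof.
case=> HB U1 U2 h0 orth; split=> //; first exact: flip_pairing.
  by move=> k; rewrite fmorph_eq0.
move=> i j; rewrite /flip orth eq_sym.
by case: eqP => [->|_]; rewrite ?rmorph0.
Qed.

Lemma rational_off_row_comb S A k : rational_off S (row_comb A chi k).
Proof. exact: (@rational_off_sum _ S k.+1 (A k) chi). Qed.
Hint Resolve rational_off_row_comb : core.

Lemma chi_span_row_comb A k : chi_span k.+1 (row_comb A chi k).
Proof. by exists (A k). Qed.

(** The matrix form S1 G S2^dagger = H of the factorization, read entrywise. *)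
Lemma gauss_borel_biorthogonal (v : bifunctional R) (F : gauss_borel (gram v)) :
  biorthogonal (supp1 v) (supp2 v) (bpair v) (gbS1 F) (gbS2 F) (gbH F).
Proof.
have HB := bpair_pairing v.
split=> //; [exact: gbS1_unitri | exact: gbS2_unitri | exact: gbH_neq0 |].
move=> k l; rewrite (@pairing_sumr _ _ _ _ _ (gbS2 F l) _ chi HB)//.
have GE i j : gram v i j = row_comb (linv (gbS1 F))
    (fun a _ => gbH F a * (linv (gbS2 F) j a)^*) i 0.
  rewrite (gbE F) /lmul /row_comb; apply: eq_bigr => a _; congr (_ * _).
  rewrite (bigD1 ord_max)//= /idiag eqxx big1 ?addr0// => b ba.
  by rewrite eq_sym (negPf (_ : (b : nat) != a)) ?mul0r.
under eq_bigr => j _.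
  rewrite (@pairing_suml _ _ _ _ HB _ (gbS1 F k) chi)//.
  under eq_bigr do rewrite -/(gram v _ _) GE.
  rewrite -/(row_comb (gbS1 F) (row_comb (linv (gbS1 F))
    (fun a _ => gbH F a * (linv (gbS2 F) j a)^*)) k 0).
  rewrite row_comb_linvr; last exact: gbS1_unitri.
  rewrite mulrCA -rmorphM /=.
  over.
rewrite -mulr_sumr -rmorph_sum -/(lmul (gbS2 F) (linv (gbS2 F)) l k).
rewrite lmul_linvr; last exact: gbS2_unitri.
by rewrite eq_sym; case: eqP; rewrite ?rmorph1 ?rmorph0 ?mulr1 ?mulr0.
Qed.

Section Expansion.
Variables (S T : set C) (B : (C -> C) -> (C -> C) -> C).
Variables (A1 A2 : imx) (h : nat -> C).
Hypothesis sys : biorthogonal S T B A1 A2 h.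
Local Notation p := (row_comb A1 chi).
Local Notation q := (row_comb A2 chi).

Lemma chi_span_basis M f : chi_span M f ->
  exists d : nat -> C, forall z, z != 0 -> f z = \sum_(i < M) d i * p i z.
Proof.
case=> c fE; exists (fun i => \sum_(j < M) c j * linv A1 j i) => z z0.
rewrite fE//; under [RHS]eq_bigr do rewrite mulr_suml.
rewrite exchange_big /=; apply: eq_bigr => j _.
rewrite -(row_comb_linv chi j z (bi_unitri1 sys)).
rewrite [row_comb (linv A1) _ _ _]/row_comb.
rewrite (@sum_lower _ _ M j (fun i => p i z))//; last exact: linv_low.
by rewrite mulr_sumr; apply: eq_bigr => i _; rewrite mulrA.
Qed.

Lemma pairing_coef M (d : nat -> C) f k : rational_off S f ->
  (forall z, z != 0 -> f z = \sum_(i < M) d i * p i z) ->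
  B f (q k) = if (k < M)%N then d k * h k else 0.
Proof.
move=> Sf fE; have HB := bi_pairing sys.
have -> : B f (q k) = B (fun z => \sum_(i < M) d i * p i z) (q k).
  apply: (pairing_eql HB (x := 0)) => //; first exact: rational_off_sum.
    exact: pairing_off0l HB.
  by move=> z z0 _; exact: fE.
rewrite (pairing_suml HB)//; case: ifPn => kM.
  rewrite (bigD1 (Ordinal kM))//= (bi_orth sys) eqxx big1 ?addr0// => i ik.
  by rewrite (bi_orth sys) (negPf (_ : (i : nat) != k)) ?mulr0.
rewrite big1// => i _; rewrite (bi_orth sys) ltn_eqF ?mulr0//.
by rewrite (leq_trans (ltn_ord i))// leqNgt.
Qed.

Lemma pairing_high M f k : chi_span M f -> (M <= k)%N -> B f (q k) = 0.
Proof.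
move=> fM Mk; have [d fE] := chi_span_basis fM.
by rewrite (pairing_coef k (chi_span_rational _ fM) fE) ltnNge Mk.
Qed.

(** The Christoffel-Darboux kernel reproduces Laurent polynomials of low
    order. *)
Lemma reproducing M M' f z : chi_span M f -> (M <= M')%N -> z != 0 ->
  \sum_(k < M') B f (q k) * (h k)^-1 * p k z = f z.
Proof.
move=> fM MM' z0; have [d fE] := chi_span_basis fM.
rewrite -(sum_widen (F := fun k => B f (q k) * (h k)^-1 * p k z) MM').
  rewrite fE//; apply: eq_bigr => k _.
  rewrite (pairing_coef k (chi_span_rational _ fM) fE) ltn_ord mulfK//.
  exact: bi_neq0 sys k.
by move=> k /andP[Mk _]; rewrite (pairing_high fM Mk) !mul0r.
Qed.

End Expansion.

Section Geronimus.
Variables (S T Sc Tc : set C) (B Bc : (C -> C) -> (C -> C) -> C).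
Variables (A1 A2 A1c A2c : imx) (h hc : nat -> C).
Variables (n m : nat) (L : int -> C).
Hypothesis sys : biorthogonal S T B A1 A2 h.
Hypothesis sysc : biorthogonal Sc Tc Bc A1c A2c hc.
Hypothesis geronimus : forall f g,
  rational_off (S `|` Sc) f -> rational_off (T `|` Tc) g ->
  Bc (fun z => laurent n m L z * f z) g = B f g.
Local Notation p := (row_comb A1 chi).
Local Notation q := (row_comb A2 chi).
Local Notation pc := (row_comb A1c chi).
Local Notation qc := (row_comb A2c chi).
Local Notation w := (2 * maxn n m)%N.
Local Notation Om := (lmul A2c (linv A2)).

Lemma connection_row k : qc k = row_comb Om q k.
Proof.
apply/funext => z; rewrite -row_comb_comp; last exact: linv_low.
apply: eq_bigr => j _; congr (_ * _).
by rewrite row_comb_linv//; exact: bi_unitri2 sys.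
Qed.

(** The coefficients come out conjugated: the pairing is antilinear in its
    second argument. *)
Lemma pairing_connection f k : rational_off S f ->
  B f (qc k) = \sum_(j < k.+1) (Om k j)^* * B f (q j).
Proof.
move=> Sf; rewrite connection_row.
by rewrite (@pairing_sumr _ _ _ _ _ (Om k) _ q (bi_pairing sys)).
Qed.

(** The adjoint of multiplication by [L] is the connection matrix, up to the
    normalization. *)
Lemma pairing_laurent_mul j k :
  Bc (fun z => laurent n m L z * p j z) (qc k) = (Om k j)^* * h j.
Proof.
rewrite geronimus// pairing_connection//.
have [jk|kj] := leqP j k; last first.
  rewrite lmul_low ?rmorph0 ?mul0r//; last exact: linv_low.
  rewrite big1// => i _; rewrite (bi_orth sys) gtn_eqF ?mulr0//.
  by rewrite (leq_ltn_trans _ kj)// -ltnS.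
rewrite -ltnS in jk; rewrite (bigD1 (Ordinal jk))//= (bi_orth sys) eqxx.
rewrite big1 ?addr0// => i ij.
by rewrite (bi_orth sys) eq_sym (negPf (_ : (i : nat) != j)) ?mulr0.
Qed.

Lemma connection_low k j : (k < j)%N -> Om k j = 0.
Proof. by apply: lmul_low; exact: linv_low. Qed.

(** [L p_j] involves only the first j + 1 + w terms of chi, and [qc k] is
    orthogonal to the first k of them. *)
Lemma connection_band k j : (j + w < k)%N -> Om k j = 0.
Proof.
move=> jk; apply/eqP; rewrite -(fmorph_eq0 (Num.conj : {rmorphism C -> C})).
rewrite -(mulIr_eq0 _ (mulIf (bi_neq0 sys j))) -pairing_laurent_mul.
apply/eqP; apply: (pairing_high sysc _ jk).
by rewrite -addSn; apply: laurent_chi_span; exact: chi_span_row_comb.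
Qed.

Lemma laurent_mul_expansion j z : z != 0 ->
  laurent n m L z * p j z =
  (\sum_(k < (j + w).+1) pc k z * (hc k)^-1 * (Om k j)^*) * h j.
Proof.
move=> z0; rewrite -(reproducing sysc
  (laurent_chi_span n m L (chi_span_row_comb A1 j)) (leqnn _) z0) addSn.
rewrite mulr_suml; apply: eq_bigr => k _; rewrite pairing_laurent_mul; ring.
Qed.

Let conj_low k j : (k < j)%N -> (Om k j)^* = 0.
Proof. by move=> kj; rewrite connection_low ?rmorph0. Qed.

Let conj_band k j : (j + w < k)%N -> (Om k j)^* = 0.
Proof. by move=> kj; rewrite connection_band ?rmorph0. Qed.

Local Notation cauchy x := (fun z : C => (x - z)^-1).

(** Here the transformed variable carries the Cauchy kernel.  Only [L x] times
    the checked Cauchy function is accessible, through [delta_cauchy]: the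
    term with [L z] is a pairing with B, the other one is reproduced. *)
Theorem geronimus_kernel_cauchy_left l x y : (w <= l)%N -> x != 0 -> y != 0 ->
  ~ S x -> ~ Sc x ->
  laurent n m L x * (\sum_(k < l) Bc (cauchy x) (qc k) * (hc k)^-1 * pc k y)
  - laurent n m L y * (\sum_(k < l) B (cauchy x) (q k) * (h k)^-1 * p k y)
  - delta n m L x y =
  - \sum_(i < w) \sum_(j < w) pc (l + i)%N y * (hc (l + i)%N)^-1
      * (Om (l + i)%N (l - w + j)%N)^* * B (cauchy x) (q (l - w + j)%N).
Proof.
move=> wl x0 y0 Sx Scx.
have HBc := bi_pairing sysc.
have rx A : ~ A x -> rational_off A (cauchy x) := @rational_off_cauchy _ A x.
have dS : rational_off Sc (delta n m L x).
  by apply: chi_span_rational; exact: delta_chi_span.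
(* [delta_cauchy] fails at z = x in general, but x is off [Sc]. *)
have second k : laurent n m L x * Bc (cauchy x) (qc k) =
    Bc (delta n m L x) (qc k) + \sum_(j < k.+1) (Om k j)^* * B (cauchy x) (q j).
  rewrite -pairing_connection; last exact: rx.
  rewrite -geronimus//; last by apply: rx => -[].
  rewrite -[X in X + _]mul1r -(pairing_linl HBc)//; last first.
    by apply: rational_off_mul => //; exact: rx.
  rewrite -[LHS]addr0 -(pairing0l HBc (rational_off_row_comb Tc A2c k)).
  rewrite -(pairing_linl HBc)//; last exact: rx.
  apply: (pairing_eql HBc (x := x)) => //.
  - by apply: rational_off_lin => //; exact: rx.
  - apply: rational_off_lin => //.
    by apply: rational_off_mul => //; exact: rx.
  - by move=> z _ zx; rewrite addr0 delta_cauchy// mul1r.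
rewrite -(@band_corner _ (fun k j => (Om k j)^*) (fun k => pc k y * (hc k)^-1)
  (fun j => B (cauchy x) (q j)))//.
rewrite -(reproducing sysc (delta_chi_span n m L x0) wl y0) addrAC.
congr (_ - _).
  rewrite mulr_sumr -sumrB; apply: eq_bigr => k _.
  by rewrite 2![laurent _ _ _ _ * _]mulrA second; ring.
rewrite mulr_sumr; apply: eq_bigr => j _.
rewrite mulrCA laurent_mul_expansion//.
by field; exact: bi_neq0 sys j.
Qed.

(** Here [L] acts on the polynomial factor [p j], and by [laurent_mul_expansion]
    the pairing of [L p_j] with the Cauchy kernel is a combination of checked
    Cauchy functions; no difference quotient arises. *)
Theorem geronimus_kernel_cauchy_right l x y : (w <= l)%N ->
  ~ T y -> ~ Tc y ->
  \sum_(k < l) (qc k x)^* * (hc k)^-1 * Bc (pc k) (cauchy y)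
  - \sum_(k < l) (q k x)^* * (h k)^-1 * B (p k) (cauchy y) =
  - \sum_(i < w) \sum_(j < w) Bc (pc (l + i)%N) (cauchy y) * (hc (l + i)%N)^-1
      * (Om (l + i)%N (l - w + j)%N)^* * (q (l - w + j)%N x)^*.
Proof.
move=> wl Ty Tcy.
have HBc := bi_pairing sysc.
have ry A : ~ A y -> rational_off A (cauchy y) := @rational_off_cauchy _ A y.
have second j : B (p j) (cauchy y) =
    (\sum_(k < (j + w).+1) Bc (pc k) (cauchy y) * (hc k)^-1 * (Om k j)^*) * h j.
  rewrite -geronimus//; last by apply: ry => -[].
  pose d k := (hc k)^-1 * (Om k j)^* * h j.
  transitivity (Bc (fun z => \sum_(k < (j + w).+1) d k * pc k z) (cauchy y)).
    apply: (pairing_eql HBc (x := 0)); [|exact: rational_off_sum|exact: ry| |].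
    - exact: rational_off_mul.
    - exact: pairing_off0l HBc.
    move=> z z0 _; rewrite laurent_mul_expansion// mulr_suml.
    by apply: eq_bigr => k _; rewrite /d; ring.
  rewrite (pairing_suml HBc)//; last exact: ry.
  by rewrite mulr_suml; apply: eq_bigr => k _; rewrite /d; ring.
rewrite -(@band_corner _ (fun k j => (Om k j)^*)
  (fun k => Bc (pc k) (cauchy y) * (hc k)^-1) (fun j => (q j x)^*))//.
congr (_ - _).
  apply: eq_bigr => k _; rewrite connection_row rmorph_sum /=.
  rewrite -mulrA mulrC [_ * Bc _ _]mulrC; congr (_ * _).
  by apply: eq_bigr => j _; rewrite rmorphM.
apply: eq_bigr => j _; rewrite second.
by field; exact: bi_neq0 sys j.
Qed.

End Geronimus.
End Biorthogonal.

(** * The four identities *)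
Section Corner.
Variable R : realType.
Local Notation C := (Cplx R).
Implicit Types (p h b : nat -> C).

Lemma invmx_seg_diag N h l : (forall k, h k != 0) ->
  invmx (seg_diag N h l) = seg_diag N (fun k => (h k)^-1) l.
Proof.
move=> h0; set D := seg_diag N h l; set D' := seg_diag N _ l.
have DD' : D *m D' = 1%:M.
  rewrite mulmx_diag -diag_const_mx; congr diag_mx.
  by apply/rowP => i; rewrite !mxE divff.
by rewrite -[RHS](mulKmx (mulmx1_unit DD').1) DD' mulmx1.
Qed.

Lemma corner_mxE N p h (M : 'M[C]_(2 * N)) b l : (forall k, h k != 0) ->
  (seg_row N p l *m invmx (seg_diag N h l) *m M *m seg_col N b (l - 2 * N)) 0 0
  = \sum_(i < 2 * N) \sum_(j < 2 * N)
      p (l + i)%N * (h (l + i)%N)^-1 * M i j * b (l - 2 * N + j)%N.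
Proof.
move=> h0; rewrite invmx_seg_diag// mxE exchange_big; apply: eq_bigr => j _ /=.
rewrite mxE mulr_suml; apply: eq_bigr => i _.
by rewrite mul_mx_diag !mxE.
Qed.

End Corner.

Theorem proposition20 (R : realType) (n m : nat) (L1 L2 : int -> Cplx R)
  (hL1 : L1 n%:Z * L1 (- m%:Z) != 0)
  (hL2 : L2 n%:Z * L2 (- m%:Z) != 0)
  (u u1 u2 : bifunctional R)
  (hsupp1 : forall z : Cplx R,
     z != 0 -> laurent n m L1 z = 0 -> ~ supp1 u z)
  (hsupp2 : forall z : Cplx R,
     z != 0 -> laurent n m L2 z = 0 -> ~ supp2 u z)
  (hu1 : geronimus1 (laurent n m L1) u u1)
  (hu2 : geronimus2 (laurent n m L2) u u2)
  (hG : quasidefinite (gram u))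
  (hG1 : quasidefinite (gram u1))
  (hG2 : quasidefinite (gram u2))
  (F : gauss_borel (gram u))
  (F1 : gauss_borel (gram u1))
  (F2 : gauss_borel (gram u2))
  (l : nat) (x1 x2 : Cplx R)
  (hl : (2 * maxn n m <= l)%N) (hx1 : x1 != 0) (hx2 : x2 != 0) :
  let N := maxn n m in
  let Om1 := lmul (gbS2 F1) (linv (gbS2 F)) in
  let Om2 := lmul (gbS1 F2) (linv (gbS1 F)) in
  [/\ ~ supp1 u x1^* -> ~ supp1 u1 x1^* ->
      laurent n m L1 x1^* * K_Cphi F1 l x1^* x2
      - laurent n m L1 x2 * K_Cphi F l x1^* x2
      - delta n m L1 x1^* x2
      = - (seg_row N (fun k => phi1 F1 k x2) l
           *m invmx (seg_diag N (gbH F1) l)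
           *m map_mx Num.conj (Omega_block N Om1 l)
           *m seg_col N (fun k => (C2 F k x1)^*) (l - 2 * N)) 0 0,

      ~ supp1 u x1^* -> ~ supp1 u2 x1^* ->
      K_Cphi F2 l x1^* x2 - K_Cphi F l x1^* x2
      = - (seg_row N (fun k => (C2 F2 k x1)^*) l
           *m invmx (seg_diag N (gbH F2) l)
           *m Omega_block N Om2 l
           *m seg_col N (fun k => phi1 F k x2) (l - 2 * N)) 0 0,

      ~ supp2 u x2^* -> ~ supp2 u1 x2^* ->
      K_phiC F1 l x1^* x2 - K_phiC F l x1^* x2
      = - (seg_row N (fun k => C1 F1 k x2) l
           *m invmx (seg_diag N (gbH F1) l)
           *m map_mx Num.conj (Omega_block N Om1 l)
           *m seg_col N (fun k => (phi2 F k x1)^*) (l - 2 * N)) 0 0 &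

      ~ supp2 u x2^* -> ~ supp2 u2 x2^* ->
      laurent n m (laurent_bar L2) x2 * K_phiC F2 l x1^* x2
      - laurent n m (laurent_bar L2) x1^* * K_phiC F l x1^* x2
      - delta n m (laurent_bar L2) x1^* x2
      = - (seg_row N (fun k => (phi2 F2 k x1)^*) l
           *m invmx (seg_diag N (gbH F2) l)
           *m Omega_block N Om2 l
           *m seg_col N (fun k => C1 F k x2) (l - 2 * N)) 0 0].
Proof.
move=> N Om1 Om2.
have sys := gauss_borel_biorthogonal F.
have sys1 := gauss_borel_biorthogonal F1.
have sys2 := flip_biorthogonal (gauss_borel_biorthogonal F2).
have sysf := flip_biorthogonal sys.
have cx1 : x1^* != 0 by rewrite fmorph_eq0.
have cx2 : x2^* != 0 by rewrite fmorph_eq0.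
have hu2f f g : rational_off (supp2 u `|` supp2 u2) f ->
    rational_off (supp1 u `|` supp1 u2) g ->
    flip (bpair u2) (fun z => laurent n m L2 z * f z) g = flip (bpair u) f g.
  by move=> rf rg; rewrite /flip hu2.
have barK : laurent_bar (laurent_bar L2) = L2.
  by apply/funext => k; rewrite /laurent_bar conjCK.
split=> ux ucx; rewrite corner_mxE; try exact: gbH_neq0.
- have key := geronimus_kernel_cauchy_left sys sys1 hu1 hl cx1 hx2 ux ucx.
  apply: etrans (etrans key _).
    by congr (_ * _ - _ * _ - _); apply: eq_bigr => k _; rewrite /C2 !conjCK.
  congr (- _); apply: eq_bigr => i _; apply: eq_bigr => j _.
  by rewrite !mxE /C2 !conjCK.
(* The second and fourth identities are the conjugates of those for the
   transposed pairings, with x1 and x2 exchanged. *)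
- have key := geronimus_kernel_cauchy_right sysf sys2 hu2f x2 hl ux ucx.
  apply: (can_inj (@conjCK (Cplx R))); apply: etrans (etrans key _).
    rewrite rmorphB !rmorph_sum /=; congr (_ - _); apply: eq_bigr => k _;
    by rewrite !rmorphM /= fmorphV !conjCK mulrC [C2 _ _ _ * _]mulrC mulrA.
  rewrite rmorphN; congr (- _); rewrite rmorph_sum; apply: eq_bigr => i _ /=.
  rewrite rmorph_sum; apply: eq_bigr => j _ /=.
  by rewrite !mxE !rmorphM /= fmorphV conjCK.
- have key := geronimus_kernel_cauchy_right sys sys1 hu1 x1 hl ux ucx.
  apply: etrans (etrans key _).
    by congr (_ - _); apply: eq_bigr => k _; rewrite conjCK.
  congr (- _); apply: eq_bigr => i _; apply: eq_bigr => j _.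
  by rewrite !mxE.
- have key := geronimus_kernel_cauchy_left sysf sys2 hu2f hl cx2 hx1 ux ucx.
  apply: (can_inj (@conjCK (Cplx R))); apply: etrans (etrans key _).
    rewrite !rmorphB !rmorphM /= !laurent_barE conj_delta// barK.
    rewrite !conjCK !rmorph_sum /=.
    congr (_ * _ - _ * _ - _); apply: eq_bigr => k _;
    by rewrite !rmorphM /= fmorphV !conjCK mulrC [phi2 _ _ _ * _]mulrC mulrA.
  rewrite rmorphN; congr (- _); rewrite rmorph_sum; apply: eq_bigr => i _ /=.
  rewrite rmorph_sum; apply: eq_bigr => j _ /=.
  by rewrite !mxE !rmorphM /= fmorphV conjCK.
Qed.
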